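(* Let $d\ge2$ be an integer and let $p,n$ be real with $p\ge n>d/2+1$. Put $\mathbf N_0=\{1,2,3,\dots\}$ and, for $\omega=(\ell,\lambda,\mu,\nu)\in\mathbf N_0\times\mathbf R^3$ and $m\in\mathbf R$, $$N_m(\omega):=\sqrt{1+2(1+\ell^2)^m\lambda^2+2(1+4\ell^2)^m\mu^2+2(1+9\ell^2)^m\nu^2}.$$ (i) Let $d\ge3$. For all $\omega=(\ell,\lambda,\mu,\nu)\in\mathbf N_0\times\mathbf R^3$, $$G_{pn}\ge G^-_{pn}(\omega),\qquad G^-_{pn}(\omega):=\frac{2\sqrt2}{(2\pi)^{d/2}}\,\frac{|S_p(\omega)|}{(\ell^pN_n(\omega)+\ell^nN_p(\omega))N_p(\omega)},$$ where $$S_p(\omega):=-\lambda+(1+\ell^2)^p\lambda(1-\mu)+(1+4\ell^2)^p\mu(\lambda-\nu)+(1+9\ell^2)^p\mu\nu.$$ (ii) Let $d=2$. For all $\omega=(\ell,\lambda,\mu,\nu)\in\mathbf N_0\times\mathbf R^3$, $$G_{pn}\ge G^-_{pn}(\omega),\qquad G^-_{pn}(\omega):=\frac{\sqrt2}\pi\,\frac{|\mathcal S_p(\omega)|}{(\ell^pN_n(\omega)+\ell^nN_p(\omega))N_p(\omega)},$$ where $$\mathcal S_p(\omega):=-\frac{\lambda\ell}{\sqrt{1+\ell^2}}+2\lambda\ell\Big(1-\frac{3\mu\ell}{\sqrt{4+\ell^2}}\Big)(1+\ell^2)^{p-3/2}$$ $$\qquad+\frac{5\mu\ell^2}{\sqrt{4+\ell^2}}\Big(\frac{3\lambda}{\sqrt{1+\ell^2}}-\frac{7\nu}{\sqrt{9+\ell^2}}\Big)(1+4\ell^2)^{p-1}+\frac{70\mu\nu\ell^2}{\sqrt{(4+\ell^2)(9+\ell^2)}}(1+9\ell^2)^{p-1}.$$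 (iii) For any $d\ge2$, with $G^-_{pn}(\omega)$ as in (i) if $d\ge3$ and as in (ii) if $d=2$, one has $G_{pn}\ge G^-_{pn}:=\sup_{\omega\in\mathbf N_0\times\mathbf R^3}G^-_{pn}(\omega)$.
   Context: Notation. $\mathbf T^d=(\mathbf R/2\pi\mathbf Z)^d$; $e_k(x)=(2\pi)^{-d/2}e^{ik\cdot x}$ for $k\in\mathbf Z^d$; $a\cdot b=\sum_ra_rb_r$ and $|a|=\sqrt{\overline a\cdot a}$ on $\mathbf C^d$; $\mathbf Z^d_0=\mathbf Z^d\setminus\{0\}$. An $\mathbf R^d$-valued distribution on $\mathbf T^d$ has a Fourier expansion $v=\sum_kv_ke_k$, $v_k=\overline{v_{-k}}\in\mathbf C^d$. For real $m$, $\mathbb H^m$ is the space of such $v$ with $k\cdot v_k=0$ for all $k$, $v_0=0$ and $\sum_{k\in\mathbf Z^d_0}|k|^{2m}|v_k|^2<\infty$, with inner product $\langle v|w\rangle_m=\sum_{k\in\mathbf Z^d_0}|k|^{2m}\overline{v_k}\cdot w_k$ and norm $\|v\|_m=\sqrt{\langle v|v\rangle_m}$. The Leray projection $\mathfrak L$ acts by $(\mathfrak Lv)_k=v_k-\frac{k\cdot v_k}{|k|^2}k$ for $k\ne0$, $(\mathfrak Lv)_0=v_0$. $\mathcal P(v,w)=\mathfrak L(v\cdot\partial w)$, $(v\cdot\partial w)_s=\sum_{r=1}^dv_r\partial_rw_s$; for $p>d/2$ it maps $\mathbb H^p\times\mathbb H^{p+1}$ to $\mathbb H^p$. For $p\ge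 n>d/2+1$, $G_{pn}$ is the sharp (i.e. minimum) constant $G$ such that $|\langle\mathcal P(v,w)|w\rangle_p|\le\frac12G(\|v\|_p\|w\|_n+\|v\|_n\|w\|_p)\|w\|_p$ for all $v\in\mathbb H^p$, $w\in\mathbb H^{p+1}$ (such constants exist). *)

(* Defs.v *)
From HB Require Import structures.
From mathcomp Require Import all_boot all_order all_algebra.
From mathcomp Require Import all_classical all_reals all_analysis.
From mathcomp Require Export complex.
Set Implicit Arguments.
Unset Strict Implicit.
Unset Printing Implicit Defensive.
Import Order.TTheory GRing.Theory Num.Theory.
Import numFieldNormedType.Exports.
Local Open Scope classical_set_scope.
Local Open Scope ring_scope.
Local Open Scope complex_scope.

(** The bilinear product [a . b] on C^d, and [|a|] = sqrt (conj a . a). *)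
Definition cdot (R : realType) (d : nat) (a b : 'rV[R[i]]_d) : R[i] :=
  \sum_(r < d) a 0 r * b 0 r.

Definition cvconj (R : realType) (d : nat) (a : 'rV[R[i]]_d) : 'rV[R[i]]_d :=
  \row_(r < d) (a 0 r)^*%C.

Definition cvnorm (R : realType) (d : nat) (a : 'rV[R[i]]_d) : R :=
  Num.sqrt (complex.Re (cdot (cvconj a) a)).

Definition zvec (R : realType) (d : nat) (k : 'rV[int]_d) : 'rV[R[i]]_d :=
  \row_(r < d) (k 0 r)%:~R.

Definition znorm (R : realType) (d : nat) (k : 'rV[int]_d) : R :=
  cvnorm (zvec R k).

Definition Zd0 (d : nat) : set 'rV[int]_d := [set k | k != 0].

(** Unconditional sum of a complex family over [D]: the real and imaginary
    parts are summed separately, each as (sum of f^+) - (sum of f^-).  This is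
    the usual value for absolutely summable families, and junk otherwise. *)
Definition rsum (R : realType) (T : choiceType) (D : set T) (f : T -> R) : R :=
  fine (\esum_(k in D) (Num.max (f k) 0)%:E)
  - fine (\esum_(k in D) (Num.max (- f k) 0)%:E).

Definition csum (R : realType) (T : choiceType) (D : set T) (f : T -> R[i])
    : R[i] :=
  rsum D (fun k => complex.Re (f k)) +i* rsum D (fun k => complex.Im (f k)).

(** A distribution on T^d is represented by the family of its Fourier
    coefficients with respect to the [e_k], [k] in Z^d.  The slow growth of the
    coefficients, which characterizes the families arising from distributions,
    is automatic for the members of the spaces [Hsp m] below. *)
Definition distr (R : realType) (d : nat) := 'rV[int]_d -> R[i].
Definition vdistr (R : realType) (d : nat) := 'rV[int]_d -> 'rV[R[i]]_d.

Definition real_vdistr (R : realType) (d : nat) (v : vdistr R d) : Prop :=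
  forall k : 'rV[int]_d, v k = cvconj (v (- k)).

Definition Hsp (R : realType) (d : nat) (m : R) : set (vdistr R d) :=
  [set v | [/\ real_vdistr v,
               forall k : 'rV[int]_d, cdot (zvec R k) (v k) = 0,
               v 0 = 0 &
               (\esum_(k in @Zd0 d)
                  (znorm R k `^ (2 * m) * cvnorm (v k) ^+ 2)%:E < +oo)%E]].

Definition Hdot (R : realType) (d : nat) (m : R) (v w : vdistr R d) : R[i] :=
  csum (@Zd0 d)
    (fun k => (znorm R k `^ (2 * m))%:C * cdot (cvconj (v k)) (w k)).

(** [Hdot m v v] is real and nonnegative. *)
Definition Hnorm (R : realType) (d : nat) (m : R) (v : vdistr R d) : R :=
  Num.sqrt (complex.Re (Hdot m v v)).

Definition expfun (R : realType) (d : nat) (k : 'rV[int]_d) (x : 'rV[R]_d)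
    : R[i] :=
  let t : R := \sum_(r < d) (k 0 r)%:~R * x 0 r in
  ((2 * pi) `^ (- (d%:R / 2)))%:C * (cos t +i* sin t).

(** The function with Fourier coefficients [u], when these are summable. *)
Definition synth (R : realType) (d : nat) (u : distr R d) (x : 'rV[R]_d)
    : R[i] :=
  csum [set: 'rV[int]_d] (fun k => u k * expfun k x).

(** Integral over T^d, as an iterated Lebesgue integral over [0, 2 pi]^d; it is
    applied to (real and imaginary parts of) continuous periodic functions. *)
Fixpoint rint_torus (R : realType) (d : nat) : ('rV[R]_d -> R) -> R :=
  match d return ('rV[R]_d -> R) -> R with
  | 0%N => fun f => f 0
  | d'.+1 => fun f =>
      \int[@lebesgue_measure R]_(t in `[0, 2 * pi])
        rint_torus (fun y : 'rV[R]_d' =>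
          f (row_mx (const_mx t : 'rV[R]_1) y : 'rV[R]_(1 + d')))
  end.

Definition cint_torus (R : realType) (d : nat) (f : 'rV[R]_d -> R[i]) : R[i] :=
  rint_torus (fun x => complex.Re (f x))
  +i* rint_torus (fun x => complex.Im (f x)).

(** Fourier coefficients of a function: f_k = int_(T^d) conj(e_k) f. *)
Definition fourier (R : realType) (d : nat) (f : 'rV[R]_d -> R[i]) : distr R d :=
  fun k => cint_torus (fun x => (expfun k x)^*%C * f x).

Definition vcoord (R : realType) (d : nat) (v : vdistr R d) (r : 'I_d)
    : distr R d :=
  fun k => v k 0 r.

(** Distributional derivative: (partial_r u)_k = i k_r u_k. *)
Definition dpartial (R : realType) (d : nat) (r : 'I_d) (u : distr R d)
    : distr R d :=
  fun k => 'i%C * (k 0 r)%:~R * u k.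

(** The pointwise product (v . partial w)_s = sum_r v_r partial_r w_s, where
    the factors are identified with functions; their Fourier coefficients are
    summable when v is in H^p and w in H^(p+1) with p > d/2. *)
Definition advect (R : realType) (d : nat) (v w : vdistr R d) : vdistr R d :=
  fun k => \row_(s < d)
    fourier (fun x : 'rV[R]_d => \sum_(r < d)
      synth (vcoord v r) x * synth (dpartial r (vcoord w s)) x) k.

Definition leray (R : realType) (d : nat) (v : vdistr R d) : vdistr R d :=
  fun k => if k == 0 then v 0
           else v k - (cdot (zvec R k) (v k) / (znorm R k ^+ 2)%:C) *: zvec R k.

Definition Pmap (R : realType) (d : nat) (v w : vdistr R d) : vdistr R d :=
  leray (advect v w).

Definition kato_bound (R : realType) (d : nat) (p n G : R) : Prop :=
  forall v w : vdistr R d, Hsp p v -> Hsp (p + 1) w ->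
    Normc.normc (Hdot p (Pmap v w) w)
    <= 1 / 2 * G * (Hnorm p v * Hnorm n w + Hnorm n v * Hnorm p w) * Hnorm p w.

(** [G] is the sharp, i.e. minimum, constant G_pn on T^d. *)
Definition is_sharp_kato (R : realType) (d : nat) (p n G : R) : Prop :=
  kato_bound d p n G /\ forall G' : R, kato_bound d p n G' -> G <= G'.

Definition Nw (R : realType) (m : R) (l : nat) (la mu nu : R) : R :=
  Num.sqrt (1 + 2 * (1 + l%:R ^+ 2) `^ m * la ^+ 2
              + 2 * (1 + 4 * l%:R ^+ 2) `^ m * mu ^+ 2
              + 2 * (1 + 9 * l%:R ^+ 2) `^ m * nu ^+ 2).

Definition Sw (R : realType) (p : R) (l : nat) (la mu nu : R) : R :=
  - la + (1 + l%:R ^+ 2) `^ p * la * (1 - mu)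
  + (1 + 4 * l%:R ^+ 2) `^ p * mu * (la - nu)
  + (1 + 9 * l%:R ^+ 2) `^ p * mu * nu.

Definition Sw2 (R : realType) (p : R) (l : nat) (la mu nu : R) : R :=
  let L : R := l%:R in
  - (la * L / Num.sqrt (1 + L ^+ 2))
  + 2 * la * L * (1 - 3 * mu * L / Num.sqrt (4 + L ^+ 2))
    * (1 + L ^+ 2) `^ (p - 3 / 2)
  + 5 * mu * L ^+ 2 / Num.sqrt (4 + L ^+ 2)
    * (3 * la / Num.sqrt (1 + L ^+ 2) - 7 * nu / Num.sqrt (9 + L ^+ 2))
    * (1 + 4 * L ^+ 2) `^ (p - 1)
  + 70 * mu * nu * L ^+ 2 / Num.sqrt ((4 + L ^+ 2) * (9 + L ^+ 2))
    * (1 + 9 * L ^+ 2) `^ (p - 1).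

Definition Gminus3 (R : realType) (d : nat) (p n : R)
    (l : nat) (la mu nu : R) : R :=
  2 * Num.sqrt 2 / (2 * pi) `^ (d%:R / 2)
  * (`|Sw p l la mu nu|
     / ((l%:R `^ p * Nw n l la mu nu + l%:R `^ n * Nw p l la mu nu)
        * Nw p l la mu nu)).

Definition Gminus2 (R : realType) (p n : R) (l : nat) (la mu nu : R) : R :=
  Num.sqrt 2 / pi
  * (`|Sw2 p l la mu nu|
     / ((l%:R `^ p * Nw n l la mu nu + l%:R `^ n * Nw p l la mu nu)
        * Nw p l la mu nu)).

Definition Gminus (R : realType) (d : nat) (p n : R)
    (l : nat) (la mu nu : R) : R :=
  if d == 2%N then Gminus2 p n l la mu nu else Gminus3 d p n l la mu nu.

(* Main.v *)
Require Import Defs.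
From mathcomp Require Import all_boot all_order all_algebra.
From mathcomp Require Import all_classical all_reals all_analysis.
From mathcomp Require Import ring lra zify.
Set Implicit Arguments.
Unset Strict Implicit.
Unset Printing Implicit Defensive.
Import Order.TTheory GRing.Theory Num.Theory.
Import numFieldNormedType.Exports.
Local Open Scope classical_set_scope.
Local Open Scope ring_scope.
Local Open Scope complex_scope.

(** A lower bound for [G_pn] is obtained by inserting one pair of fields into
    the Kato inequality.  Let [e1], [e2] be two coordinate directions.

    The field [v] has the two modes [+l e1] and [-l e1], with amplitudes [+i]
    and [-i] times [e2].  The field [w] has the fourteen modes
    [+(e2 + j l e1)] and [-(e2 + j l e1)], [|j| <= 3], with real amplitudes
    [W_j U_j], where [U_j] is a unit vector orthogonal to [e2 + j l e1], and
    [W_0 = 1], [W_1 = la], [W_2 = mu], [W_3 = nu], [W_(-j) = (-1)^j W_j].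
    Multiplication by [v] moves the index [j] by one, so that, with
    [a_j = 1 + j^2 l^2] and [c_ij = U_i . U_j],
      [<P(v,w)|w>_p = 2 (2 pi)^(-d/2) sum_j a_j^p W_j
                        (W_(j+1) c_(j,j+1) - W_(j-1) c_(j,j-1))];
    the Leray projection disappears because [w] is divergence free
    ([Hdot_Pmap], [Hdot_trial]).  The alternating choice of [W_(-j)] makes the
    terms of [j] and [-j] equal, and the sum becomes [-2 Strial]
    ([transferE]).  The norms are [||v||_m = sqrt 2 l^m] and
    [||w||_m = sqrt 2 N_m] ([Hnorm_v], [Hnorm_w]), and dividing gives
    [kato_trial_le].

    For [d >= 3] all [U_j] may be taken equal to a third coordinate vector;
    then every [c_ij] is 1 and [Strial] is [S_p].

    For [d = 2] the direction of [U_j] is forced up to sign: it is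
    [(1, - j l) / sqrt a_j], and [Strial] becomes [Splanar].  The quantity
    [Sw2] of the theorem coincides with [Splanar] for [l = 1] but is a
    different function for [l >= 2].  Both have the form
    [la X + la mu Y + mu nu Z], and the coefficients of [Sw2] are bounded in
    absolute value by those of [Splanar], which are nonnegative
    ([Sw2_le_Splanar]).  Since [N_m] is even in each of [la], [mu], [nu], the
    bound with [Splanar] at [(|la|, |mu|, |nu|)] implies the one with [Sw2].

    All series met on the way have finitely many nonzero terms, and the
    Fourier coefficients of [v . partial w] are integrals of trigonometric
    polynomials ([cint_torus_trig]). *)

(** * Summation over finitely many indices *)

Lemma Re_add (R : realType) (x y : R[i]) :
  complex.Re (x + y) = complex.Re x + complex.Re y.
Proof. by case: x; case: y. Qed.

Lemma Im_add (R : realType) (x y : R[i]) :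
  complex.Im (x + y) = complex.Im x + complex.Im y.
Proof. by case: x; case: y. Qed.

Lemma Re_sum (R : realType) (I : Type) (s : seq I) (P : pred I) (f : I -> R[i]) :
  complex.Re (\sum_(i <- s | P i) f i) = \sum_(i <- s | P i) complex.Re (f i).
Proof. exact: (big_morph _ (@Re_add R) erefl). Qed.

Lemma Im_sum (R : realType) (I : Type) (s : seq I) (P : pred I) (f : I -> R[i]) :
  complex.Im (\sum_(i <- s | P i) f i) = \sum_(i <- s | P i) complex.Im (f i).
Proof. exact: (big_morph _ (@Im_add R) erefl). Qed.

Lemma complex_eta (R : realType) (z : R[i]) :
  complex.Re z +i* complex.Im z = z.
Proof. by case: z. Qed.

Lemma esum_fin (R : realType) (T : choiceType) (I : finType) (q : I -> T)
    (D : set T) (f : T -> R) :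
  injective q -> (forall i, D (q i)) -> (forall k, 0 <= f k) ->
  (forall k, (forall i, k != q i) -> f k = 0) ->
  \esum_(k in D) (f k)%:E = (\sum_i f (q i))%:E.
Proof.
move=> qI qD f0 fS.
have -> : \esum_(k in D) (f k)%:E = \esum_(k in range q) (f k)%:E.
  rewrite esum_mkcond [RHS]esum_mkcond; apply: eq_esum => k _.
  case: ifPn => [_|kD]; case: ifPn => [kq|kq] //.
    rewrite fS// => i; apply: contra kq => /eqP ->.
    by rewrite inE; exists i.
  by move: kD; rewrite notin_setE; move: kq; rewrite inE => -[i _ <-] [].
rewrite esum_fset; last 2 first.
- exact: finite_image.
- by move=> k _; rewrite lee_fin.
rewrite fsbig_image; last by move=> i j _ _ /qI.
rewrite -[RHS]sumEFin.
have -> : [set: I] = [set` enum I] by apply/seteqP; split=> i //= _; rewrite mem_enum.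
by rewrite -fsbig_seq ?enum_uniq// big_enum.
Qed.

Lemma rsum_fin (R : realType) (T : choiceType) (I : finType) (q : I -> T)
    (D : set T) (f : T -> R) :
  injective q -> (forall i, D (q i)) ->
  (forall k, (forall i, k != q i) -> f k = 0) ->
  rsum D f = \sum_i f (q i).
Proof.
move=> qI qD fS; rewrite /rsum.
rewrite (esum_fin (q := q) (f := fun k => Num.max (f k) 0))//; first last.
- by move=> k /fS ->; rewrite maxxx.
- by move=> k; rewrite le_max lexx orbT.
rewrite (esum_fin (q := q) (f := fun k => Num.max (- f k) 0))//; first last.
- by move=> k /fS ->; rewrite oppr0 maxxx.
- by move=> k; rewrite le_max lexx orbT.
rewrite /= -sumrB; apply: eq_bigr => i _.
have [h|h] := leP 0 (f (q i)).
  have h' : - f (q i) <= 0 by rewrite oppr_le0.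
  by rewrite (max_r h') subr0.
have h' : 0 <= - f (q i) by rewrite oppr_ge0 ltW.
by rewrite (max_l h') opprK add0r.
Qed.

(** Reduces every series of the proof to a finite sum: the family is carried by
    the range of an injective [q] defined on a finite type. *)
Lemma csum_fin (R : realType) (T : choiceType) (I : finType) (q : I -> T)
    (D : set T) (f : T -> R[i]) :
  injective q -> (forall i, D (q i)) ->
  (forall k, (forall i, k != q i) -> f k = 0) ->
  csum D f = \sum_i f (q i).
Proof.
move=> qI qD fS; rewrite /csum.
rewrite !(rsum_fin (q := q))//; try by move=> k /fS ->.
by rewrite -[RHS]complex_eta Re_sum Im_sum.
Qed.

(** * Integrals of trigonometric polynomials over the torus *)

Definition zdot (R : realType) (d : nat) (k : 'rV[int]_d) (x : 'rV[R]_d) : R :=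
  \sum_(r < d) (k 0 r)%:~R * x 0 r.

Definition cis (R : realType) (t : R) : R[i] := cos t +i* sin t.

Lemma Rintegral_FTC2 (R : realType) (f F : R -> R) (a b : R) :
  a < b -> (forall x : R, is_derive x (1 : R) F (f x)) -> continuous f ->
  \int[@lebesgue_measure R]_(t in `[a, b]) f t = F b - F a.
Proof.
move=> ab dF cf.
have cF : continuous F.
  move=> x; apply: differentiable_continuous; apply/derivable1_diffP.
  exact: ex_derive.
rewrite /Rintegral (@continuous_FTC2 _ f F)//.
- by apply: continuous_subspaceT => x; exact: cf.
- split.
  + by move=> x _; apply: ex_derive.
  + by apply: cvg_at_right_filter; exact: cF.
  + by apply: cvg_at_left_filter; exact: cF.
- by move=> x _; rewrite derive1E; apply: derive_val.
Qed.


Lemma periodicz (R : realType) (f : R -> R) (m : int) (b : R) :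
  periodic f (pi *+ 2) -> f (m%:~R * (2 * pi) + b) = f b.
Proof.
have -> : m%:~R * (2 * pi) = (pi *+ 2) *~ m :> R.
  by rewrite mulr_natl mulrzl.
move=> pf; case: m => n; first by rewrite -pmulrn addrC periodicn.
by rewrite NegzE mulrNz -pmulrn -[LHS](periodicn pf n.+1) addrAC addNr add0r.
Qed.

Lemma trig_continuous (R : realType) (m : int) (a b s : R) :
  continuous (fun t : R => a * cos (m%:~R * t + s) + b * sin (m%:~R * t + s)).
Proof.
move=> x; apply: differentiable_continuous; apply/derivable1_diffP.
exact: ex_derive.
Qed.

(** The phase [s] is what lets one-dimensional integrals be iterated: in
    [rint_torus_trig] it absorbs the coordinates that are already fixed.  For
    [m = 0] the integrand is constant; otherwise it has a [2 pi]-periodic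
    antiderivative. *)
Lemma Rintegral_trig (R : realType) (m : int) (a b s : R) :
  \int[@lebesgue_measure R]_(t in `[0, 2 * pi])
     (a * cos (m%:~R * t + s) + b * sin (m%:~R * t + s))
  = if m == 0 then (2 * pi) * (a * cos s + b * sin s) else 0.
Proof.
have pi2 : 0 < 2 * pi :> R by rewrite mulr_gt0 ?pi_gt0.
have cf := @trig_continuous R m a b s.
case: eqP => [m0|/eqP m0].
  have dF (x : R) : is_derive x (1 : R) (fun t : R => t * (a * cos s + b * sin s))
      (a * cos (m%:~R * x + s) + b * sin (m%:~R * x + s)).
    apply: is_derive_eq.
    by rewrite m0 mul0r add0r scaler0 add0r /GRing.scale/= mulr1.
  by rewrite (Rintegral_FTC2 pi2 dF)// mul0r subr0.
have mR : m%:~R != 0 :> R by rewrite intr_eq0.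
have dF (x : R) : is_derive x (1 : R) (fun t : R =>
  m%:~R^-1 * (a * sin (m%:~R * t + s) - b * cos (m%:~R * t + s)))
      (a * cos (m%:~R * x + s) + b * sin (m%:~R * x + s)).
  by apply: is_derive_eq; rewrite /GRing.scale/=; field.
rewrite (Rintegral_FTC2 pi2 dF)//.
rewrite (periodicz _ _ (@sinD2pi R)) (periodicz _ _ (@cosD2pi R)).
by rewrite mulr0 add0r subrr.
Qed.

Lemma Rintegral_sum_continuous (R : realType) (I : Type) (r : seq I) (f : I -> R -> R)
    (a b : R) :
  (forall i, continuous (f i)) ->
  \int[@lebesgue_measure R]_(t in `[a, b]) (\sum_(i <- r) f i t)
  = \sum_(i <- r) \int[@lebesgue_measure R]_(t in `[a, b]) f i t.
Proof.
move=> cf.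
have int g : continuous g ->
    (@lebesgue_measure R).-integrable `[a, b] (EFin \o g).
  move=> cg; apply: continuous_compact_integrable.
    exact: segment_compact.
  by apply: continuous_subspaceT => x; exact: cg.
have cs s : continuous (fun t => \sum_(i <- s) f i t).
  elim: s => [|i s IH] t.
    rewrite (_ : (fun _ => _) = cst 0); first exact: cst_continuous.
    by apply/funext => u; rewrite big_nil.
  rewrite (_ : (fun _ => _) = (f i \+ (fun u => \sum_(j <- s) f j u))).
    by apply: continuousD; [exact: cf|exact: IH].
  by apply/funext => u; rewrite big_cons.
elim: r => [|i r IH].
  rewrite big_nil (_ : (fun _ => _) = cst 0).
    by rewrite Rintegral_cst// mul0r.
  by apply/funext => u; rewrite big_nil.
rewrite big_cons -IH -RintegralD//; [|exact: int|exact/int/cs].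
by apply: eq_Rintegral => t _; rewrite big_cons.
Qed.

Lemma zdot_row_mx (R : realType) (d : nat) (k : 'rV[int]_(1 + d)) (t : R)
    (y : 'rV[R]_d) :
  zdot k (row_mx (const_mx t : 'rV[R]_1) y)
  = (k 0 0)%:~R * t + zdot (rsubmx k) y.
Proof.
rewrite /zdot (big_split_ord _ _ _ (m := 1)) /= big_ord1 row_mxEl mxE.
rewrite (_ : lshift d 0 = 0); last exact: val_inj.
by congr (_ + _); apply: eq_bigr => r _; rewrite row_mxEr mxE.
Qed.

Lemma rV_eq0_split (d : nat) (k : 'rV[int]_(1 + d)) :
  (k == 0) = (k 0 0 == 0) && (rsubmx k == 0).
Proof.
apply/eqP/andP => [->|[/eqP k0 /eqP kr]].
  by rewrite mxE eqxx; split => //; apply/eqP/rowP => r; rewrite !mxE.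
apply/rowP => r; case: (split_ordP r) => j ->.
  by rewrite mxE ord1 (_ : lshift d 0 = 0)//; exact: val_inj.
by have /rowP/(_ j) := kr; rewrite !mxE.
Qed.

(** Orthogonality of the exponentials, for a whole finite sum at once, so that
    at each level of the iterated integral the inner integral is again an
    explicit trigonometric polynomial and its integrability is clear. *)
Lemma rint_torus_trig (R : realType) (d : nat) (I : finType)
    (k : I -> 'rV[int]_d) (a b s : I -> R) :
  rint_torus (fun x : 'rV[R]_d =>
    \sum_i (a i * cos (zdot (k i) x + s i) + b i * sin (zdot (k i) x + s i)))
  = \sum_i if k i == 0 then (2 * pi) ^+ d * (a i * cos (s i) + b i * sin (s i))
           else 0.
Proof.
elim: d k a b s => [|d IH] k a b s /=.
  by apply: eq_bigr => i _; rewrite thinmx0 eqxx /zdot big_ord0 add0r expr0 mul1r.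
pose c i : R := if rsubmx (k i : 'rV_(1 + d)) == 0 then (2 * pi) ^+ d else 0.
transitivity (\int[@lebesgue_measure R]_(t in `[0%R, (2 * pi)%R])
  \sum_i (c i * a i * cos ((k i 0 0)%:~R * t + s i)
          + c i * b i * sin ((k i 0 0)%:~R * t + s i))).
  apply: eq_Rintegral => t _.
  rewrite (_ : rint_torus _ = rint_torus (fun x : 'rV[R]_d => \sum_i
     (a i * cos (zdot (rsubmx (k i : 'rV_(1 + d))) x + ((k i 0 0)%:~R * t + s i))
   + b i * sin (zdot (rsubmx (k i : 'rV_(1 + d))) x + ((k i 0 0)%:~R * t + s i))))).
    rewrite IH; apply: eq_bigr => i _; rewrite /c; case: ifP => _.
      by rewrite -!mulrA mulrDr.
    by rewrite !mul0r addr0.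
  congr rint_torus; apply/funext => y; apply: eq_bigr => i _.
  by rewrite zdot_row_mx [_ + zdot _ _]addrC addrA.
rewrite Rintegral_sum_continuous; last by move=> i; exact: trig_continuous.
apply: eq_bigr => i _; rewrite Rintegral_trig (@rV_eq0_split d (k i)) /c.
case: eqP => //= _; case: ifP => _; last by rewrite !mul0r addr0 mulr0.
by rewrite exprS; ring.
Qed.

Lemma zdotD (R : realType) (d : nat) (h k : 'rV[int]_d) (x : 'rV[R]_d) :
  zdot (h + k) x = zdot h x + zdot k x.
Proof.
by rewrite /zdot -big_split/=; apply: eq_bigr => r _; rewrite mxE intrD mulrDl.
Qed.

Lemma zdotN (R : realType) (d : nat) (k : 'rV[int]_d) (x : 'rV[R]_d) :
  zdot (- k) x = - zdot k x.
Proof.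
by rewrite /zdot -sumrN; apply: eq_bigr => r _; rewrite mxE mulrNz mulNr.
Qed.

Lemma cisD (R : realType) (s t : R) : cis (s + t) = cis s * cis t.
Proof.
rewrite /cis sinD cosD.
rewrite -[RHS]/((cos s * cos t - sin s * sin t)
  +i* (cos s * sin t + sin s * cos t)).
by rewrite [cos s * sin t + _]addrC.
Qed.

Lemma conj_cis (R : realType) (t : R) : (cis t)^*%C = cis (- t).
Proof. by rewrite /cis cosN sinN. Qed.

Lemma cint_torus_trig (R : realType) (d : nat) (I : finType)
    (k : I -> 'rV[int]_d) (c : I -> R[i]) :
  cint_torus (fun x : 'rV[R]_d => \sum_i c i * cis (zdot (k i) x))
  = ((2 * pi) ^+ d)%:C * \sum_(i | k i == 0) c i.
Proof.
rewrite /cint_torus.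
pose a i := complex.Re (c i); pose b i := complex.Im (c i).
have ReE x : complex.Re (\sum_i c i * cis (zdot (k i) x))
    = \sum_i (a i * cos (zdot (k i) x + 0) + (- b i) * sin (zdot (k i) x + 0)).
  rewrite Re_sum; apply: eq_bigr => i _; rewrite /a /b addr0.
  by case: (c i) => u v; rewrite mulNr.
have ImE x : complex.Im (\sum_i c i * cis (zdot (k i) x))
    = \sum_i (b i * cos (zdot (k i) x + 0) + a i * sin (zdot (k i) x + 0)).
  rewrite Im_sum; apply: eq_bigr => i _; rewrite /a /b addr0.
  by case: (c i) => u v; rewrite addrC.
rewrite (funext ReE) (funext ImE) !rint_torus_trig cos0 sin0.
rewrite [X in _ = _ * X]big_mkcond/= mulr_sumr.
rewrite -[RHS]complex_eta Re_sum Im_sum; congr (_ +i* _);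
  apply: eq_bigr => i _; case: ifP => _; rewrite ?mulr0// /a /b;
  by case: (c i) => u v /=; rewrite ?mulr0 ?mulr1 ?mul0r ?addr0 ?subr0.
Qed.

Definition ebasis_scale (R : realType) (d : nat) : R := (2 * pi) `^ (- (d%:R / 2)).

Lemma ebasis_scale_sqr (R : realType) (d : nat) :
  ebasis_scale R d ^+ 2 * (2 * pi) ^+ d = 1.
Proof.
rewrite /ebasis_scale -powR_mulrn ?powR_ge0// -powRrM -powR_mulrn; last first.
  by rewrite mulr_ge0// pi_ge0.
rewrite -powRD; last by rewrite mulf_neq0 ?implybT// gt_eqF// pi_gt0.
by rewrite (_ : _ + _ = 0) ?powRr0//; field.
Qed.

Lemma expfunE (R : realType) (d : nat) (k : 'rV[int]_d) (x : 'rV[R]_d) :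
  expfun k x = (ebasis_scale R d)%:C * cis (zdot k x).
Proof. by []. Qed.

Lemma conj_expfun (R : realType) (d : nat) (k : 'rV[int]_d) (x : 'rV[R]_d) :
  (expfun k x)^*%C = (ebasis_scale R d)%:C * cis (- zdot k x).
Proof. by rewrite expfunE -conj_cis [LHS]rmorphM; congr (_ * _); exact: conjc_real. Qed.

Arguments cis : simpl never.
Arguments expfun : simpl never.

(** * Distributions with finitely many Fourier modes *)

Definition supported_on (d : nat) (K : finType) (s : K -> 'rV[int]_d)
  (V : nmodType) (u : 'rV[int]_d -> V) : Prop :=
  forall m, (forall i, m != s i) -> u m = 0.

Section FiniteModes.
Variables (R : realType) (d : nat) (I J : finType).
Variables (q : I -> 'rV[int]_d) (k : J -> 'rV[int]_d).
Hypotheses (qI : injective q) (kI : injective k).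

Lemma synth_fin (u : distr R d) (x : 'rV[R]_d) : supported_on q u ->
  synth u x = \sum_i u (q i) * expfun (q i) x.
Proof.
move=> uq; rewrite /synth (csum_fin (q := q))// => m /uq ->.
by rewrite mul0r.
Qed.

(** The convolution formula: pointwise products of exponentials add
    frequencies.  Two of the three factors [(2 pi)^(-d/2)] cancel against the
    volume of the torus. *)
Lemma advect_fin (v w : vdistr R d) (m : 'rV[int]_d) :
  supported_on q v -> supported_on k w ->
  advect v w m = (ebasis_scale R d)%:C *:
    \sum_i \sum_(j | q i + k j == m)
      ('i%C * cdot (v (q i)) (zvec R (k j))) *: w (k j).
Proof.
move=> vq wk; apply/rowP => s; rewrite !mxE /fourier.
have E (x : 'rV[R]_d) : (expfun m x)^*%C * (\sum_(r < d)
      synth (vcoord v r) x * synth (dpartial r (vcoord w s)) x)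
  = \sum_(ij : I * J) ((ebasis_scale R d ^+ 3)%:C * ('i%C *
       cdot (v (q ij.1)) (zvec R (k ij.2)) * w (k ij.2) 0 s))
     * cis (zdot (q ij.1 + k ij.2 - m) x).
  have vE r : synth (vcoord v r) x = \sum_i v (q i) 0 r * expfun (q i) x.
    by apply: synth_fin => h /vq vh; rewrite /vcoord vh mxE.
  have wE r : synth (dpartial r (vcoord w s)) x
      = \sum_j 'i%C * (k j 0 r)%:~R * w (k j) 0 s * expfun (k j) x.
    rewrite /synth (csum_fin (q := k))// => h /wk wh.
    by rewrite /dpartial /vcoord wh mxE mulr0 mul0r.
  under eq_bigr => r _ do rewrite vE wE big_distrlr/= pair_big/=.
  rewrite conj_expfun exchange_big/= mulr_sumr; apply: eq_bigr => -[i j] _ /=.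
  rewrite !zdotD zdotN !cisD /cdot.
  rewrite mulr_sumr mulr_sumr !mulr_suml mulr_sumr mulr_suml.
  apply: eq_bigr => r _.
  by rewrite !expfunE mxE rmorphXn/=; ring.
rewrite (funext E) cint_torus_trig -mulr_sumr mulrA -rmorphM/=.
rewrite (_ : _ * _ ^+ 3 = ebasis_scale R d); last first.
  by rewrite exprSr mulrA [_ * ebasis_scale R d ^+ 2]mulrC ebasis_scale_sqr mul1r.
congr (_ * _); rewrite summxE.
under [RHS]eq_bigr => i _ do rewrite summxE big_mkcond/=.
rewrite pair_big/= big_mkcond/=; apply: eq_bigr => -[i j] _ /=.
by rewrite subr_eq0 !mxE.
Qed.

End FiniteModes.

Lemma cdotDl (R : realType) (d : nat) (a b c : 'rV[R[i]]_d) :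
  cdot (a + b) c = cdot a c + cdot b c.
Proof.
by rewrite /cdot -big_split/=; apply: eq_bigr => r _; rewrite mxE mulrDl.
Qed.

Lemma cdotZl (R : realType) (d : nat) (x : R[i]) (a c : 'rV[R[i]]_d) :
  cdot (x *: a) c = x * cdot a c.
Proof.
by rewrite /cdot mulr_sumr; apply: eq_bigr => r _; rewrite mxE mulrA.
Qed.

Lemma cdot0l (R : realType) (d : nat) (c : 'rV[R[i]]_d) : cdot 0 c = 0.
Proof. by rewrite /cdot big1// => r _; rewrite mxE mul0r. Qed.

Lemma cdot0r (R : realType) (d : nat) (c : 'rV[R[i]]_d) : cdot c 0 = 0.
Proof. by rewrite /cdot big1// => r _; rewrite mxE mulr0. Qed.

Lemma cvconjD (R : realType) (d : nat) (a b : 'rV[R[i]]_d) :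
  cvconj (a + b) = cvconj a + cvconj b.
Proof. by apply/rowP => r; rewrite !mxE [LHS]rmorphD. Qed.

Lemma cvconjZ (R : realType) (d : nat) (x : R[i]) (a : 'rV[R[i]]_d) :
  cvconj (x *: a) = x^*%C *: cvconj a.
Proof. by apply/rowP => r; rewrite !mxE [LHS]rmorphM. Qed.

Lemma cvconj0 (R : realType) (d : nat) : cvconj (0 : 'rV[R[i]]_d) = 0.
Proof. by apply/rowP => r; rewrite !mxE [LHS]rmorph0. Qed.

Lemma cdot_conj_sum (R : realType) (d : nat) (I : Type) (s : seq I)
    (P : pred I) (f : I -> 'rV[R[i]]_d) (c : 'rV[R[i]]_d) :
  cdot (cvconj (\sum_(i <- s | P i) f i)) c
  = \sum_(i <- s | P i) cdot (cvconj (f i)) c.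
Proof.
apply: (big_morph (fun a => cdot (cvconj a) c)).
- by move=> a b; rewrite cvconjD cdotDl.
- by rewrite cvconj0 cdot0l.
Qed.

Lemma cvconj_zvec (R : realType) (d : nat) (k : 'rV[int]_d) :
  cvconj (zvec R k) = zvec R k.
Proof. by apply/rowP => r; rewrite !mxE [LHS]rmorph_int. Qed.

(** The Leray projection is orthogonal, hence invisible against a
    divergence-free coefficient. *)
Lemma cdot_leray (R : realType) (d : nat) (u : vdistr R d) (k : 'rV[int]_d)
    (b : 'rV[R[i]]_d) : k != 0 -> cdot (zvec R k) b = 0 ->
  cdot (cvconj (leray u k)) b = cdot (cvconj (u k)) b.
Proof.
move=> /negbTE k0 kb; rewrite /leray k0 -scaleNr cvconjD cvconjZ cdotDl cdotZl.
by rewrite cvconj_zvec kb mulr0 addr0.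
Qed.

Section FiniteModesHdot.
Variables (R : realType) (d : nat) (J : finType) (k : J -> 'rV[int]_d).
Hypotheses (kI : injective k) (k0 : forall j, k j != 0).

Lemma Hdot_fin (m : R) (v w : vdistr R d) : supported_on k w ->
  Hdot m v w = \sum_j (znorm R (k j) `^ (2 * m))%:C
                      * cdot (cvconj (v (k j))) (w (k j)).
Proof.
move=> wk; rewrite /Hdot (csum_fin (q := k))// => h /wk ->.
by rewrite cdot0r mulr0.
Qed.

Lemma Hdot_Pmap (I : finType) (q : I -> 'rV[int]_d) (p : R)
    (v w : vdistr R d) :
  injective q -> supported_on q v -> supported_on k w ->
  (forall j, cdot (zvec R (k j)) (w (k j)) = 0) ->
  Hdot p (Pmap v w) w = (ebasis_scale R d)%:C *
    \sum_j \sum_i \sum_(j' | q i + k j' == k j)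
      (znorm R (k j) `^ (2 * p))%:C *
      (('i%C * cdot (v (q i)) (zvec R (k j')))^*%C
       * cdot (cvconj (w (k j'))) (w (k j))).
Proof.
move=> qI vq wk kperp; rewrite Hdot_fin// mulr_sumr; apply: eq_bigr => j _.
rewrite cdot_leray// (advect_fin qI kI _ vq wk) cvconjZ cdotZl.
rewrite [(_%:C)^*%C]conjc_real mulrCA; congr (_ * _).
rewrite cdot_conj_sum mulr_sumr; apply: eq_bigr => i _.
rewrite cdot_conj_sum mulr_sumr; apply: eq_bigr => j' _.
by rewrite cvconjZ cdotZl.
Qed.

Definition modes (c : J -> 'rV[R[i]]_d) : vdistr R d :=
  fun m => \sum_(j | k j == m) c j.

Lemma modesE c j : modes c (k j) = c j.
Proof.
by rewrite /modes (eq_bigl (pred1 j)) ?big_pred1_eq// => i; rewrite inj_eq.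
Qed.

Lemma modes_supp c : supported_on k (modes c).
Proof.
by move=> m mk; rewrite /modes big_pred0// => j; rewrite eq_sym (negbTE (mk j)).
Qed.

(** The involution [s] pairs each frequency with its opposite, which expresses
    that the field is real. *)
Lemma modes_Hsp (m : R) (c : J -> 'rV[R[i]]_d) (s : J -> J) :
  (forall j, k (s j) = - k j) -> (forall j, c (s j) = cvconj (c j)) ->
  (forall j, cdot (zvec R (k j)) (c j) = 0) ->
  Hsp m (modes c).
Proof.
move=> ks cs kc.
have cases (h : 'rV[int]_d) : (exists j, h = k j) \/ (forall j, h != k j).
  have [/existsP[j /eqP ->]|/existsPn hk] := boolP [exists j, h == k j].
    by left; exists j.
  by right.
split.
- move=> h; have [[j ->]|hk] := cases h.
    rewrite -ks !modesE cs; apply/rowP => r; rewrite !mxE.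
    by rewrite [RHS]conjcK.
  rewrite !modes_supp ?cvconj0// => j.
  by apply: contra (hk (s j)) => /eqP; rewrite ks => <-; rewrite opprK.
- move=> h; have [[j ->]|hk] := cases h; first by rewrite modesE.
  by rewrite modes_supp// cdot0r.
- by rewrite modes_supp// => j; rewrite eq_sym.
- rewrite (esum_fin (q := k)) ?ltry//.
  + by move=> h; rewrite mulr_ge0 ?powR_ge0 ?sqr_ge0.
  + move=> h hk; rewrite modes_supp// /cvnorm cvconj0 cdot0l sqrtr0.
    by rewrite expr0n mulr0.
Qed.

End FiniteModesHdot.

Lemma znorm_pow (R : realType) (d : nat) (k : 'rV[int]_d) (m : R) :
  znorm R k `^ (2 * m) = (\sum_r ((k 0 r)%:~R : R) ^+ 2) `^ m.
Proof.
rewrite /znorm /cvnorm cvconj_zvec powRrM; congr (_ `^ _).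
rewrite powR_mulrn ?sqrtr_ge0// /cdot.
rewrite (_ : complex.Re _ = \sum_r ((k 0 r)%:~R : R) ^+ 2).
  by rewrite sqr_sqrtr// sumr_ge0// => r _; rewrite sqr_ge0.
rewrite Re_sum; apply: eq_bigr => r _; rewrite mxE.
rewrite -[_%:~R]/((k 0 r)%:~R) -(rmorph_int (real_complex R)) -rmorphM/=.
by rewrite expr2.
Qed.

Lemma sum_two (V : zmodType) (d : nat) (i0 i1 : 'I_d) (f : 'I_d -> V) :
  i0 != i1 -> (forall r, r != i0 -> r != i1 -> f r = 0) ->
  \sum_r f r = f i0 + f i1.
Proof.
move=> i01 f0; rewrite (bigD1 i0)//= (bigD1 i1) 1?eq_sym//= big1 ?addr0//.
by move=> r /andP[r0 r1]; exact: f0.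
Qed.

(** * The trial fields *)

Definition bsign (b : bool) : int := if b then 1 else -1.
(** The index [j] of the modes of [w], which runs from -3 to 3, is encoded by a
    natural number smaller than 7. *)
Definition offset (j : nat) : int := j%:Z - 3.

Section Trial.
Variables (R : realType) (d : nat) (i0 i1 : 'I_d) (l : nat).
Hypotheses (i01 : i0 != i1) (l0 : (0 < l)%N).

Definition vfreq (b : bool) : 'rV[int]_d :=
  \row_r (if r == i0 then bsign b * l%:Z else 0).
Definition wfreq (x : bool * 'I_7) : 'rV[int]_d :=
  \row_r (if r == i0 then bsign x.1 * offset x.2 * l%:Z
          else if r == i1 then bsign x.1 else 0).

Let i10 : (i1 == i0) = false. Proof. by rewrite eq_sym (negbTE i01). Qed.

Lemma vfreq_inj : injective vfreq.
Proof.
move=> b b' /rowP/(_ i0); rewrite !mxE eqxx /bsign.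
by case: b b' => -[] //; lia.
Qed.

Lemma vfreq_neq0 b : vfreq b != 0.
Proof.
apply/eqP => /rowP/(_ i0); rewrite !mxE eqxx /bsign; case: b => /=; lia.
Qed.

Lemma wfreq_neq0 x : wfreq x != 0.
Proof.
by apply/eqP => /rowP/(_ i1); rewrite !mxE i10 eqxx /bsign; case: x.1.
Qed.

Lemma wfreq_inj : injective wfreq.
Proof.
move=> [b j] [b' j'] /rowP E; move: (E i0) (E i1); rewrite !mxE i10 !eqxx /=.
have bb : bsign b = bsign b' -> b = b' by case: b b' {E} => -[].
move=> e0 /bb bE; move: e0; rewrite {}bE => e0.
have ln0 : l%:Z != 0 by lia.
congr (_, _); apply: val_inj => /=; move: e0.
by move/(mulIf ln0); rewrite /offset /bsign; case: b' {E bb} => /=; lia.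
Qed.

Lemma vfreqN b : vfreq (~~ b) = - vfreq b.
Proof.
by apply/rowP => r; rewrite !mxE; case: ifP; case: b; rewrite /bsign /=; lia.
Qed.

Lemma wfreqN x : wfreq (~~ x.1, x.2) = - wfreq x.
Proof.
apply/rowP => r; rewrite !mxE /=; case: ifP => _; last case: ifP => _;
  by case: x.1; rewrite /bsign /=; lia.
Qed.

(** The selection rule: interaction with [v] preserves the sign of the
    frequency and moves [j] by one, in a direction that depends on both
    signs. *)
Lemma vfreq_wfreq b1 b j b' j' :
  (vfreq b1 + wfreq (b', j') == wfreq (b, j))
  = (b' == b) && (bsign b1 + bsign b * offset j' == bsign b * offset j).
Proof.
apply/eqP/andP => [/rowP E|[/eqP -> /eqP E]].
  move: (E i0) (E i1); rewrite !mxE i10 !eqxx /=.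
  have bb : bsign b' = bsign b -> b' = b by case: b b' {E} => -[].
  rewrite add0r => e0 /bb e1; split; first exact/eqP.
  apply/eqP; move: e0; rewrite e1 -mulrDl.
  by apply: mulIf; lia.
apply/rowP => r; rewrite !mxE /=; case: ifP => _; first by rewrite -mulrDl E.
by rewrite add0r.
Qed.

Definition wfreq_sq (j : nat) : R := 1 + (offset j)%:~R ^+ 2 * l%:R ^+ 2.

Lemma znorm_vfreq b m : znorm R (vfreq b) `^ (2 * m) = (l%:R `^ m) ^+ 2.
Proof.
rewrite znorm_pow (sum_two i01); last first.
  by move=> r /negbTE r0 _; rewrite mxE r0 expr0n.
rewrite !mxE eqxx i10 expr0n addr0 rmorphM exprMn /= -[(l : int)%:~R]/(l%:R).
rewrite (_ : _ ^+ 2 = 1) ?mul1r; last by case: b; rewrite /bsign ?rmorphN1 /= ?sqrrN expr1n.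
by rewrite -!powR_mulrn ?powR_ge0// -!powRrM mulrC.
Qed.

Lemma znorm_wfreq x m : znorm R (wfreq x) `^ (2 * m) = wfreq_sq x.2 `^ m.
Proof.
rewrite znorm_pow (sum_two i01); last first.
  by move=> r /negbTE r0 /negbTE r1; rewrite mxE r0 r1 expr0n.
rewrite !mxE !eqxx i10 !rmorphM !exprMn /= -[(l : int)%:~R]/(l%:R).
rewrite (_ : (bsign x.1)%:~R ^+ 2 = 1) ?mul1r; last first.
  by case: x.1; rewrite /bsign ?rmorphN1 /= ?sqrrN expr1n.
by rewrite addrC.
Qed.

Variables (U : nat -> 'rV[R]_d) (W : nat -> R).
Hypothesis Uperp : forall j, (offset j)%:~R * l%:R * U j 0 i0 + U j 0 i1 = 0.
Definition gram j j' : R := \sum_r U j 0 r * U j' 0 r.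
Hypothesis Uunit : forall j, gram j j = 1.

(** The factor [i] is compensated by the one of the derivative, so that all
    contributions to the scalar product are real. *)
Definition vamp (b : bool) : 'rV[R[i]]_d :=
  \row_r (if r == i1 then (bsign b)%:~R * 'i%C else 0).
Definition wamp (x : bool * 'I_7) : 'rV[R[i]]_d :=
  \row_r (W x.2 * U x.2 0 r)%:C.

Definition vtrial := modes vfreq vamp.
Definition wtrial := modes wfreq wamp.

Lemma vtrialE b : vtrial (vfreq b) = vamp b.
Proof. exact: (modesE vfreq_inj). Qed.

Lemma wtrialE x : wtrial (wfreq x) = wamp x.
Proof. exact: (modesE wfreq_inj). Qed.

Lemma vamp_divfree b : cdot (zvec R (vfreq b)) (vamp b) = 0.
Proof.
rewrite /cdot (sum_two i01); last first.
  by move=> r /negbTE r0 _; rewrite !mxE r0 mul0r.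
by rewrite !mxE eqxx i10 (negbTE i01) eqxx mulr0 mul0r addr0.
Qed.

Lemma wamp_divfree x : cdot (zvec R (wfreq x)) (wamp x) = 0.
Proof.
rewrite /cdot (sum_two i01); last first.
  by move=> r /negbTE r0 /negbTE r1; rewrite !mxE r0 r1 mul0r.
rewrite !mxE !eqxx i10.
rewrite -!(rmorph_int (real_complex R)) -!rmorphM -rmorphD/=.
rewrite (_ : _ + _ = 0)//.
rewrite !rmorphM /= -[(l : int)%:~R]/(l%:R).
transitivity ((bsign x.1)%:~R * W x.2 *
  ((offset x.2)%:~R * l%:R * U x.2 0 i0 + U x.2 0 i1)); first by ring.
by rewrite Uperp mulr0.
Qed.

Lemma vtrial_Hsp m : Hsp m vtrial.
Proof.
apply: (modes_Hsp vfreq_inj vfreq_neq0 m (s := negb)).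
- exact: vfreqN.
- move=> b; apply/rowP => r; rewrite !mxE; case: ifP => _; last by rewrite [RHS]rmorph0.
  by rewrite /bsign; case: b => /=; rewrite ?mulrN1z ?mulr1z; simpc.
- exact: vamp_divfree.
Qed.

Lemma wtrial_Hsp m : Hsp m wtrial.
Proof.
apply: (modes_Hsp wfreq_inj wfreq_neq0 m (s := fun x => (~~ x.1, x.2))).
- exact: wfreqN.
- by move=> b; apply/rowP => r; rewrite !mxE [RHS]conjc_real.
- exact: wamp_divfree.
Qed.

Lemma cdot_wamp x y :
  cdot (cvconj (wamp x)) (wamp y) = (W x.2 * W y.2 * gram x.2 y.2)%:C.
Proof.
rewrite /cdot /gram mulr_sumr rmorph_sum; apply: eq_bigr => r _.
rewrite !mxE [(_%:C)^*%C]conjc_real -rmorphM; congr (_%:C); ring.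
Qed.

Lemma cdot_vamp x : cdot (cvconj (vamp x)) (vamp x) = 1.
Proof.
rewrite /cdot (sum_two i01); last first.
  by move=> r _ /negbTE r1; rewrite !mxE r1 mulr0.
rewrite !mxE eqxx (negbTE i01) mulr0 add0r.
by rewrite /bsign; case: x; rewrite ?mulrN1z ?mulr1z; simpc.
Qed.

Lemma Hnorm_v m : Hnorm m vtrial = Num.sqrt 2 * l%:R `^ m.
Proof.
rewrite /Hnorm (Hdot_fin vfreq_inj vfreq_neq0); last exact: modes_supp.
under eq_bigr => b _ do
  rewrite vtrialE cdot_vamp mulr1 znorm_vfreq.
rewrite big_bool /= -mulr2n -[_ ^+ 2 *+ 2]mulr_natl sqrtrM// sqrtr_sqr.
by rewrite ger0_norm// powR_ge0.
Qed.

Lemma Hnorm_w m :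
  Hnorm m wtrial = Num.sqrt (2 * \sum_(j < 7) wfreq_sq j `^ m * W j ^+ 2).
Proof.
rewrite /Hnorm (Hdot_fin wfreq_inj wfreq_neq0); last exact: modes_supp.
under eq_bigr => x _ do
  rewrite wtrialE cdot_wamp znorm_wfreq Uunit mulr1 -expr2 -rmorphM/=.
rewrite -rmorph_sum /=; congr Num.sqrt.
rewrite -(pair_bigA _ (fun _ (j : 'I_7) => wfreq_sq j `^ m * W j ^+ 2))/=.
by rewrite big_bool/= mulr_natl.
Qed.

(** The value of [<P(v,w)|w>_p], up to a constant: nearest-neighbour
    interactions, antisymmetric in the two neighbours. *)
Definition transfer (p : R) : R := \sum_(j : 'I_7) \sum_(j' : 'I_7)
  wfreq_sq j `^ p * (W j' * W j * gram j' j) *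
  ((j' == j.+1 :> nat)%:R - (j == j'.+1 :> nat)%:R).

(** The two overall signs of the frequencies contribute equally, whence the
    factor 2. *)
Lemma Hdot_trial p :
  Hdot p (Pmap vtrial wtrial) wtrial = (2 * ebasis_scale R d * transfer p)%:C.
Proof.
rewrite (Hdot_Pmap wfreq_inj wfreq_neq0 p vfreq_inj); first last.
- by move=> x; rewrite wtrialE wamp_divfree.
- exact: modes_supp.
- exact: modes_supp.
pose t (b b1 : bool) (j j' : 'I_7) : R :=
  if bsign b1 + bsign b * offset j' == bsign b * offset j
  then wfreq_sq j `^ p * (W j' * W j * gram j' j) * - (bsign b1 * bsign b)%:~R else 0.
transitivity ((ebasis_scale R d)%:C * (\sum_b \sum_j \sum_b1 \sum_j' t b b1 j j')%:C).
  congr (_ * _); rewrite [in RHS]pair_bigA/= rmorph_sum; apply: eq_bigr => -[b j] _ /=.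
  rewrite rmorph_sum; apply: eq_bigr => b1 _.
  rewrite big_mkcond/= -(pair_bigA _ (fun b' j' =>
    if vfreq b1 + wfreq (b', j') == wfreq (b, j) then
      (znorm R (wfreq (b, j)) `^ (2 * p))%:C *
      (('i%C * cdot (vtrial (vfreq b1)) (zvec R (wfreq (b', j'))))^*%C *
       cdot (cvconj (wtrial (wfreq (b', j')))) (wtrial (wfreq (b, j)))) else 0))/=.
  rewrite (bigD1 b)//= [X in _ + X]big1 ?addr0; last first.
    by move=> b' /negbTE b'b; rewrite big1// => j' _; rewrite vfreq_wfreq b'b.
  rewrite rmorph_sum; apply: eq_bigr => j' _; rewrite vfreq_wfreq eqxx /= /t.
  case: ifP => _; last by rewrite rmorph0.
  rewrite !wtrialE vtrialE cdot_wamp znorm_wfreq /=.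
  have -> : ('i%C * cdot (vamp b1) (zvec R (wfreq (b, j'))))^*%C
      = (- (bsign b1 * bsign b)%:~R)%:C.
    rewrite /cdot (sum_two i01); last first.
      by move=> r _ /negbTE r1; rewrite !mxE r1 mul0r.
    rewrite !mxE eqxx i10 (negbTE i01) mul0r add0r eqxx /bsign.
    by case: b1 b => -[]; rewrite ?mulrN1z ?mulr1z; simpc.
  by rewrite -!rmorphM; congr (_%:C); ring.
rewrite -rmorphM /=; congr (_%:C).
rewrite [2 * _]mulrC -mulrA; congr (_ * _).
rewrite big_bool/= mulr2n mulrDl !mul1r; congr (_ + _); apply: eq_bigr => j _;
  rewrite big_bool/= -big_split; apply: eq_bigr => j' _ /=; rewrite /t /bsign /offset.
all: case: j j' => [j jlt] [j' jlt'] /=.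
- rewrite (_ : (1 + _ == _) = (j == j'.+1)); last by apply/eqP/eqP; lia.
  rewrite (_ : (-1 + _ == _) = (j' == j.+1)); last by apply/eqP/eqP; lia.
  by do 2![case: ifP => _]; rewrite ?mulr1 ?mulrN1 ?opprK ?mulr1z ?mulrN1z /=; ring.
- rewrite (_ : (1 + _ == _) = (j' == j.+1)); last by apply/eqP/eqP; lia.
  rewrite (_ : (-1 + _ == _) = (j == j'.+1)); last by apply/eqP/eqP; lia.
  by do 2![case: ifP => _]; rewrite ?mulr1 ?mulrN1 ?opprK ?mulr1z ?mulrN1z /=; ring.
Qed.

End Trial.

Local Close Scope complex_scope.

(** * The trial value and the resulting lower bounds *)

(** The alternating signs on the negative indices make the terms of [j] and
    [-j] in [transfer] equal instead of opposite. *)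
Definition wprofile (R : realType) (la mu nu : R) (j : nat) : R :=
  nth 0 [:: - nu; mu; - la; 1; la; mu; nu] j.

(** The numbers [c01], [c12], [c23] are the cosines of the angles between
    consecutive polarizations [U_j]. *)
Definition Strial (R : realType) (p : R) (l : nat) (c01 c12 c23 la mu nu : R) : R :=
  - (la * c01) + (1 + l%:R ^+ 2) `^ p * la * (c01 - mu * c12)
  + (1 + 4 * l%:R ^+ 2) `^ p * mu * (la * c12 - nu * c23)
  + (1 + 9 * l%:R ^+ 2) `^ p * mu * nu * c23.

Lemma wfreq_sqE (R : realType) (l j : nat) :
  wfreq_sq R l j = 1 + (j%:R - 3) ^+ 2 * l%:R ^+ 2.
Proof. by rewrite /wfreq_sq /offset rmorphB. Qed.

Lemma wfreq_sq_values (R : realType) (l : nat) :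
  (wfreq_sq R l 0 = 1 + 9 * l%:R ^+ 2) * (wfreq_sq R l 1 = 1 + 4 * l%:R ^+ 2)
  * (wfreq_sq R l 2 = 1 + l%:R ^+ 2) * (wfreq_sq R l 3 = 1)
  * (wfreq_sq R l 4 = 1 + l%:R ^+ 2) * (wfreq_sq R l 5 = 1 + 4 * l%:R ^+ 2)
  * (wfreq_sq R l 6 = 1 + 9 * l%:R ^+ 2).
Proof. by do !split; rewrite wfreq_sqE; ring. Qed.

Lemma sum_wfreq_sq (R : realType) (l : nat) (la mu nu m : R) :
  2 * (\sum_(j < 7) wfreq_sq R l j `^ m * wprofile la mu nu j ^+ 2)
  = 2 * (1 + 2 * (1 + l%:R ^+ 2) `^ m * la ^+ 2
              + 2 * (1 + 4 * l%:R ^+ 2) `^ m * mu ^+ 2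
              + 2 * (1 + 9 * l%:R ^+ 2) `^ m * nu ^+ 2).
Proof.
rewrite !big_ord_recl big_ord0 /= /bump /= !add1n /= !wfreq_sq_values /wprofile /=.
by rewrite powR1; ring.
Qed.

Lemma transferE (R : realType) (d l : nat) (U : nat -> 'rV[R]_d)
    (p c01 c12 c23 la mu nu : R) :
  gram U 2 3 = c01 -> gram U 3 4 = c01 -> gram U 1 2 = c12 -> gram U 4 5 = c12 ->
  gram U 0 1 = c23 -> gram U 5 6 = c23 ->
  transfer l U (wprofile la mu nu) p = -2 * Strial p l c01 c12 c23 la mu nu.
Proof.
move=> e23 e34 e12 e45 e01 e56.
have gramC j j' : gram U j j' = gram U j' j.
  by apply: eq_bigr => r _; rewrite mulrC.
rewrite /transfer.
under eq_bigr => j _ do rewrite !big_ord_recl big_ord0 /= /bump /= !add1n /=.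
rewrite !big_ord_recl big_ord0 /= /bump /= !add1n /= !wfreq_sq_values /wprofile /=.
rewrite (gramC 1%N 0%N) (gramC 2%N 1%N) (gramC 3%N 2%N) (gramC 4%N 3%N) (gramC 5%N 4%N).
rewrite (gramC 6%N 5%N) e01 e12 e23 e34 e45 e56.
by rewrite powR1 /Strial; ring.
Qed.

Lemma Nw_ge1 (R : realType) (m la mu nu : R) (l : nat) : 1 <= Nw m l la mu nu.
Proof.
rewrite /Nw -[leLHS]sqrtr1 ler_wsqrtr// -!addrA lerDl.
by rewrite !(sqr_ge0, powR_ge0, addr_ge0, mulr_ge0)//.
Qed.

(** The Kato inequality for the trial fields, solved for [G].  The Gram
    entries of [U] are required to be symmetric about the central index 3. *)
Lemma kato_trial_le (R : realType) (d l : nat) (i0 i1 : 'I_d) (U : nat -> 'rV[R]_d)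
    (p n G c01 c12 c23 la mu nu : R) :
  kato_bound d p n G -> i0 != i1 -> (0 < l)%N ->
  (forall j, (offset j)%:~R * l%:R * U j 0 i0 + U j 0 i1 = 0) ->
  (forall j, gram U j j = 1) ->
  gram U 2 3 = c01 -> gram U 3 4 = c01 -> gram U 1 2 = c12 -> gram U 4 5 = c12 ->
  gram U 0 1 = c23 -> gram U 5 6 = c23 ->
  2 * Num.sqrt 2 / (2 * pi) `^ (d%:R / 2)
  * (`|Strial p l c01 c12 c23 la mu nu|
     / ((l%:R `^ p * Nw n l la mu nu + l%:R `^ n * Nw p l la mu nu)
        * Nw p l la mu nu)) <= G.
Proof.
move=> hG i01 l0 Uperp Uunit e23 e34 e12 e45 e01 e56.
have := hG _ _ (@vtrial_Hsp R d i0 i1 l i01 l0 p)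
  (wtrial_Hsp i01 l0 (wprofile la mu nu) Uperp (p + 1)).
rewrite Hdot_trial// (transferE l p la mu nu e23 e34 e12 e45 e01 e56).
rewrite !Hnorm_v// !Hnorm_w// !sum_wfreq_sq.
rewrite ![Num.sqrt (2 * _)]sqrtrM// -!/(Nw _ _ _ _ _).
rewrite /ebasis_scale powRN.
set B := _ `^ (d%:R / 2).
have B0 : 0 < B by rewrite powR_gt0// mulr_gt0// pi_gt0.
have Np := Nw_ge1 p la mu nu l; have Nn := Nw_ge1 n la mu nu l.
have lp : 0 < (l%:R : R) `^ p by rewrite powR_gt0// ltr0n.
have ln : 0 < (l%:R : R) `^ n by rewrite powR_gt0// ltr0n.
move: Np Nn lp ln.
set Np := Nw p _ _ _ _; set Nn := Nw n _ _ _ _.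
set lp := _ `^ p; set ln := _ `^ n; set S := Strial _ _ _ _ _ _ _ _.
move=> hNp hNn hlp hln.
have Np0 : 0 < Np by rewrite (lt_le_trans ltr01).
have Nn0 : 0 < Nn by rewrite (lt_le_trans ltr01).
rewrite /Normc.normc /= expr0n addr0 sqrtr_sqr.
have -> : `|2 * B^-1 * (-2 * S)| = 2 * B^-1 * (2 * `|S|).
  have B2 : 0 <= 2 * B^-1 by rewrite mulr_ge0 ?invr_ge0 ?(ltW B0).
  by rewrite mulNr mulrN normrN normrM (normrM 2 S) (ger0_norm B2) normr_nat.
set s := Num.sqrt 2; have s2 : s * s = 2 by rewrite -expr2 sqr_sqrtr.
have s0 : 0 < s by rewrite sqrtr_gt0.
set D := lp * Nn + ln * Np.
have D0 : 0 < D by rewrite addr_gt0// mulr_gt0.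
move=> H.
have {H}: 2 * B^-1 * (2 * `|S|) <= G * s * (D * Np).
  apply: le_trans H _; rewrite /D -subr_ge0 le_eqVlt; apply/orP; left.
  rewrite eq_sym subr_eq0; apply/eqP.
  transitivity (G * (s * s) / 2 * s * ((lp * Nn + ln * Np) * Np));
    first by rewrite s2; field.
  by field.
move=> H; rewrite mulrA ler_pdivrMr ?mulr_gt0//.
rewrite -(ler_pM2r s0) (_ : 2 * s / B * `|S| * s = 2 * B^-1 * (2 * `|S|)).
  by rewrite [leRHS]mulrAC.
transitivity (2 * (s * s) / B * `|S|); first by field; rewrite gt_eqF.
by rewrite s2; field; rewrite gt_eqF.
Qed.

Lemma Gminus3_le (R : realType) (d : nat) (p n G : R) (l : nat) (la mu nu : R) :
  kato_bound d p n G -> (3 <= d)%N -> (0 < l)%N ->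
  Gminus3 d p n l la mu nu <= G.
Proof.
move=> hG d3 l0.
pose i0 : 'I_d := Ordinal (leq_trans (isT : (0 < 3)%N) d3).
pose i1 : 'I_d := Ordinal (leq_trans (isT : (1 < 3)%N) d3).
pose i2 : 'I_d := Ordinal d3.
pose U (j : nat) : 'rV[R]_d := delta_mx 0 i2.
have UU j j' : gram U j j' = 1.
  rewrite /gram (bigD1 i2)//= big1 ?addr0; first by rewrite !mxE !eqxx mulr1.
  by move=> r /negbTE r2; rewrite !mxE r2 andbF mul0r.
have Uperp j : (offset j)%:~R * l%:R * U j 0 i0 + U j 0 i1 = 0.
  by rewrite !mxE /= mulr0 addr0.
have := @kato_trial_le R d l i0 i1 U p n G 1 1 1 la mu nu hG isT l0 Uperp
  (fun j => UU j j) (UU _ _) (UU _ _) (UU _ _) (UU _ _) (UU _ _) (UU _ _).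
by rewrite /Gminus3 (_ : Strial _ _ _ _ _ _ _ _ = Sw p l la mu nu)// /Strial /Sw; ring.
Qed.

(** The value of [Strial] when each [U_j] lies in the plane of the
    frequencies, hence is [(1, - j l) / sqrt (1 + j^2 l^2)]. *)
Definition Splanar (R : realType) (p : R) (l : nat) (la mu nu : R) : R :=
  let s1 := Num.sqrt (1 + l%:R ^+ 2) in
  let s2 := Num.sqrt (1 + 4 * l%:R ^+ 2) in
  let s3 := Num.sqrt (1 + 9 * l%:R ^+ 2) in
  Strial p l s1^-1 ((1 + 2 * l%:R ^+ 2) / (s1 * s2))
    ((1 + 6 * l%:R ^+ 2) / (s2 * s3)) la mu nu.

Lemma kato_planar_le (R : realType) (d : nat) (p n G : R) (l : nat) (la mu nu : R) :
  kato_bound d p n G -> (2 <= d)%N -> (0 < l)%N ->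
  2 * Num.sqrt 2 / (2 * pi) `^ (d%:R / 2)
  * (`|Splanar p l la mu nu|
     / ((l%:R `^ p * Nw n l la mu nu + l%:R `^ n * Nw p l la mu nu)
        * Nw p l la mu nu)) <= G.
Proof.
move=> hG d2 l0; rewrite /Splanar.
set s1 := Num.sqrt (1 + _); set s2 := Num.sqrt (1 + 4 * _).
set s3 := Num.sqrt (1 + 9 * _).
pose i0 : 'I_d := Ordinal (leq_trans (isT : (0 < 2)%N) d2).
pose i1 : 'I_d := Ordinal d2.
have i01 : i0 != i1 by [].
have i10 : (i1 == i0) = false by [].
pose U (j : nat) : 'rV[R]_d :=
  \row_r (if r == i0 then (Num.sqrt (wfreq_sq R l j))^-1
          else if r == i1 then - ((j%:R - 3) * l%:R) / Num.sqrt (wfreq_sq R l j)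
          else 0).
have wfreq_sq_gt0 j : 0 < wfreq_sq R l j.
  by rewrite wfreq_sqE -exprMn ltr_wpDr// sqr_ge0.
have UU j j' : gram U j j' = (1 + (j%:R - 3) * (j'%:R - 3) * l%:R ^+ 2)
    / (Num.sqrt (wfreq_sq R l j) * Num.sqrt (wfreq_sq R l j')).
  rewrite /gram (sum_two i01); last first.
    by move=> r /negbTE r0 /negbTE r1; rewrite !mxE r0 r1 mul0r.
  rewrite !mxE !eqxx i10.
  have h k : Num.sqrt (wfreq_sq R l k) != 0 by rewrite gt_eqF// sqrtr_gt0.
  by field; rewrite !h.
have Uperp j : (offset j)%:~R * l%:R * U j 0 i0 + U j 0 i1 = 0.
  rewrite !mxE !eqxx i10 /offset rmorphB /=.
  by rewrite -[(j : int)%:~R]/(j%:R : R) mulNr addrN.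
have Uunit j : gram U j j = 1.
  rewrite UU -(expr2 (Num.sqrt _)) sqr_sqrtr ?ltW// -expr2 -wfreq_sqE divff//.
  by rewrite gt_eqF.
apply: (kato_trial_le la mu nu hG i01 l0 Uperp Uunit); rewrite UU !wfreq_sq_values
  ?sqrtr1 -/s1 -/s2 -/s3.
- by rewrite mulr1 (_ : 1 + _ = 1) ?div1r//; ring.
- by rewrite mul1r (_ : 1 + _ = 1) ?div1r//; ring.
- by congr (_ / _); ring.
- by congr (_ / _); ring.
- by rewrite [s3 * s2]mulrC; congr (_ / _); ring.
- by congr (_ / _); ring.
Qed.

(** Comparison of one coefficient of [Sw2], of the form [g A - h B], with the
    corresponding coefficient [c (A - B)] of [Splanar]. *)
Lemma normr_subM_le (R : realType) (g h c A B : R) :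
  0 <= g -> g <= c -> g <= h -> 0 <= B -> B <= A -> h * B <= g * A ->
  `|g * A - h * B| <= c * (A - B).
Proof.
move=> g0 gc gh B0 BA hg; rewrite ger0_norm ?subr_ge0//.
have h1 : g * B <= h * B by rewrite ler_wpM2r.
have h2 : g * (A - B) <= c * (A - B) by rewrite ler_wpM2r ?subr_ge0.
by rewrite (le_trans _ h2)// mulrBr lerB.
Qed.

(** Coefficientwise comparison.  Write [a_j = 1 + j^2 l^2] and
    [a_j^p = a_j B_j] with [B_j = a_j^(p-1)], so that
    [1 <= B_1 <= B_2 <= B_3].  Each coefficient reduces by [normr_subM_le] to
    polynomial inequalities in [l >= 1]. *)
Lemma Sw2_le_Splanar (R : realType) (p : R) (l : nat) (la mu nu : R) :
  1 <= p -> (0 < l)%N ->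
  `|Sw2 p l la mu nu| <= `|Splanar p l `|la| `|mu| `|nu| |.
Proof.
move=> p1 l0; rewrite /Sw2 /Splanar /Strial.
set s1 := Num.sqrt (1 + _); set s2 := Num.sqrt (1 + 4 * _).
set s3 := Num.sqrt (1 + 9 * _).
have L1 : 1 <= l%:R :> R by rewrite ler1n.
move: L1; set L : R := l%:R => L1.
set t2 := Num.sqrt (4 + L ^+ 2); pose t3 := Num.sqrt (9 + L ^+ 2).
have L2 : 1 <= L ^+ 2 by rewrite expr_ge1// (le_trans ler01).
rewrite [Num.sqrt ((4 + _) * _)]sqrtrM -/t2 -/t3; last by lra.
pose a1 := 1 + L ^+ 2; pose a2 := 1 + 4 * L ^+ 2; pose a3 := 1 + 9 * L ^+ 2.
have a1p : 0 < a1 by rewrite /a1; lra.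
have a2p : 0 < a2 by rewrite /a2; lra.
have a3p : 0 < a3 by rewrite /a3; lra.
have s1p : 0 < s1 by rewrite sqrtr_gt0.
have s2p : 0 < s2 by rewrite sqrtr_gt0.
have s3p : 0 < s3 by rewrite sqrtr_gt0.
have t2p : 0 < t2 by rewrite sqrtr_gt0; lra.
have t3p : 0 < t3 by rewrite sqrtr_gt0; lra.
have s1E : s1 ^+ 2 = a1 by rewrite sqr_sqrtr// ltW.
have s2E : s2 ^+ 2 = a2 by rewrite sqr_sqrtr// ltW.
have s3E : s3 ^+ 2 = a3 by rewrite sqr_sqrtr// ltW.
have t2E : t2 ^+ 2 = 4 + L ^+ 2 by rewrite sqr_sqrtr//; lra.
have t3E : t3 ^+ 2 = 9 + L ^+ 2 by rewrite sqr_sqrtr//; lra.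
pose B1 := a1 `^ (p - 1); pose B2 := a2 `^ (p - 1); pose B3 := a3 `^ (p - 1).
have pow_split a : 0 < a -> a `^ p = a * a `^ (p - 1).
  move=> a0; rewrite -[X in X * _]powRr1 ?ltW// -powRD ?(gt_eqF a0) ?implybT//.
  by congr (_ `^ _); ring.
have E1 : (1 + L ^+ 2) `^ (p - 3 / 2) = B1 / s1.
  rewrite -[LHS]/(a1 `^ _) (_ : p - 3 / 2 = (p - 1) - 1 / 2); last by field.
  rewrite powRB ?(gt_eqF a1p) ?implybT// div1r.
  by rewrite -/B1 /s1 powR12_sqrt// ltW.
have B11 : 1 <= B1.
  by rewrite /B1 -[leLHS](powRr0 a1) ler_powR ?subr_ge0// /a1; lra.
have B12 : B1 <= B2.
  by apply: ge0_ler_powR; rewrite ?nnegrE ?subr_ge0 ?(ltW a1p) ?(ltW a2p) ?(ltW a3p)//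
    /a1 /a2; lra.
have B23 : B2 <= B3.
  by apply: ge0_ler_powR; rewrite ?nnegrE ?subr_ge0 ?(ltW a1p) ?(ltW a2p) ?(ltW a3p)//
    /a3 /a2; lra.
rewrite E1 -/a1 -/a2 -/a3 !pow_split// -/B1 -/B2 -/B3.
pose c12 := (1 + 2 * L ^+ 2) / (s1 * s2).
pose c23 := (1 + 6 * L ^+ 2) / (s2 * s3).
have sn0 : [/\ s1 != 0, s2 != 0, s3 != 0, t2 != 0 & t3 != 0].
  by split; rewrite gt_eqF.
have an0 : [/\ a1 != 0, a2 != 0 & a3 != 0] by split; rewrite gt_eqF.
have [[s1n s2n s3n t2n t3n] [a1n a2n a3n]] := (sn0, an0).
pose X := 2 * L / (a1 * s1) * (a1 * B1) - L / s1 * 1.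
pose Y := 15 * L ^+ 2 / (a2 * t2 * s1) * (a2 * B2)
          - 6 * L ^+ 2 / (a1 * s1 * t2) * (a1 * B1).
pose Z := 70 * L ^+ 2 / (a3 * t2 * t3) * (a3 * B3)
          - 35 * L ^+ 2 / (a2 * t2 * t3) * (a2 * B2).
have L0 : 0 <= L by lra.
have LL : L <= L ^+ 2 by nra.
have pos := (L0, ltW s1p, ltW s2p, ltW s3p, ltW t2p, ltW t3p, ltW a1p, ltW a2p, ltW a3p).
have hX : `|X| <= s1^-1 * (a1 * B1 - 1).
  have u : 0 < a1 * s1 by rewrite mulr_gt0.
  apply: normr_subM_le => //.
  - by rewrite divr_ge0// ?mulr_ge0// ltW.
  - rewrite ler_pdivrMr// mulrA mulrAC mulVf// mul1r /a1; nra.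
  - rewrite invfM mulrA ler_wpM2r ?invr_ge0 ?(ltW s1p)//.
    rewrite ler_pdivrMr// /a1; nra.
  - by rewrite /a1; nra.
  - rewrite mulr1 (_ : 2 * L / (a1 * s1) * (a1 * B1) = 2 * L * B1 / s1).
      by rewrite ler_wpM2r ?invr_ge0 ?(ltW s1p)//; nra.
    by field; rewrite a1n s1n.
have hY : `|Y| <= c12 * (a2 * B2 - a1 * B1).
  have u : 0 < a2 * t2 * s1 by rewrite !mulr_gt0.
  (* Cauchy-Schwarz for the vectors (1, 2 L) and (L, 2). *)
  have st : 5 * L <= s2 * t2.
    rewrite -(ler_pXn2r (n := 2)) ?nnegrE ?mulr_ge0 ?pos//.
    by rewrite !exprMn s2E t2E /a2; nra.
  apply: normr_subM_le => //.
  - by rewrite divr_ge0 ?mulr_ge0 ?sqr_ge0 ?pos.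
  - rewrite ler_pdivrMr// /c12.
    rewrite [leRHS](_ : _ = (1 + 2 * L ^+ 2) * (s2 * t2)); last first.
      by rewrite -s2E; field; rewrite s1n s2n.
    by nra.
  - rewrite ler_pdivrMr//.
    rewrite (_ : _ * (a2 * t2 * s1) = 6 * L ^+ 2 * a2 / a1); last first.
      by field; rewrite a1n s1n t2n.
    by rewrite ler_pdivlMr// /a1 /a2; nra.
  - by rewrite mulr_ge0 ?pos//; lra.
  - by rewrite ler_pM ?pos//; rewrite /a1 /a2; lra.
  - rewrite (_ : _ * (a1 * B1) = 6 * L ^+ 2 * B1 / (s1 * t2)); last first.
      by field; rewrite a1n s1n t2n.
    rewrite (_ : _ * (a2 * B2) = 15 * L ^+ 2 * B2 / (s1 * t2)); last first.
      by field; rewrite a2n s1n t2n.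
    by rewrite ler_wpM2r ?invr_ge0 ?mulr_ge0 ?pos//; nra.
have hZ : `|Z| <= c23 * (a3 * B3 - a2 * B2).
  have u : 0 < a3 * t2 * t3 by rewrite !mulr_gt0.
  (* Cauchy-Schwarz for the vectors (1, 3 L) and (L, 3). *)
  have st : 10 * L <= s3 * t3.
    rewrite -(ler_pXn2r (n := 2)) ?nnegrE ?mulr_ge0 ?pos//.
    by rewrite !exprMn s3E t3E /a3; nra.
  (* After squaring, the difference of the two sides is
     4 (x - 1) (9 x^2 - x - 1) with x = L^2 >= 1. *)
  have st' : 7 * L * s2 <= (1 + 6 * L ^+ 2) * t2.
    rewrite -(ler_pXn2r (n := 2)) ?nnegrE ?mulr_ge0 ?pos//; last by nra.
    rewrite !exprMn s2E t2E /a2 -subr_ge0.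
    rewrite (_ : _ - _ = 4 * (L ^+ 2 - 1)
      * (9 * L ^+ 2 * L ^+ 2 - L ^+ 2 - 1)); last by ring.
    by rewrite !mulr_ge0//; nra.
  apply: normr_subM_le => //.
  - by rewrite divr_ge0 ?mulr_ge0 ?sqr_ge0 ?pos.
  - rewrite ler_pdivrMr// /c23.
    rewrite [leRHS](_ : _ = (1 + 6 * L ^+ 2) * t2 * (s3 * t3) / s2); last first.
      by rewrite -s3E; field; rewrite s2n s3n.
    rewrite ler_pdivlMr// [leLHS](_ : _ = 7 * L * s2 * (10 * L)); last by ring.
    by rewrite ler_pM ?mulr_ge0 ?pos.
  - rewrite ler_pdivrMr//.
    rewrite (_ : _ * (a3 * t2 * t3) = 35 * L ^+ 2 * a3 / a2); last first.
      by field; rewrite a2n t3n t2n.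
    by rewrite ler_pdivlMr// /a3 /a2; nra.
  - by rewrite mulr_ge0 ?pos//; lra.
  - by rewrite ler_pM ?pos//; rewrite /a3 /a2; lra.
  - rewrite (_ : _ * (a2 * B2) = 35 * L ^+ 2 * B2 / (t2 * t3)); last first.
      by field; rewrite a2n t3n t2n.
    rewrite (_ : _ * (a3 * B3) = 70 * L ^+ 2 * B3 / (t2 * t3)); last first.
      by field; rewrite a3n t3n t2n.
    by rewrite ler_wpM2r ?invr_ge0 ?mulr_ge0 ?pos//; nra.
rewrite [X in `|X| <= _](_ : _ = la * X + la * mu * Y + mu * nu * Z); last first.
  rewrite /X /Y /Z; field.
  by rewrite s1n t2n t3n a1n a2n a3n.
rewrite [leRHS](_ : _ = `| `|la| * (s1^-1 * (a1 * B1 - 1))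
   + `|la| * `|mu| * (c12 * (a2 * B2 - a1 * B1))
   + `|mu| * `|nu| * (c23 * (a3 * B3 - a2 * B2))|); last first.
  by congr `|_|; rewrite -/c12 -/c23; ring.
apply: le_trans (ler_normD _ _) _; apply: le_trans (lerD (ler_normD _ _) (lexx _)) _.
apply: le_trans (ler_norm _).
by rewrite !normrM !lerD// ler_wpM2l ?mulr_ge0.
Qed.

Lemma Nw_abs (R : realType) (m la mu nu : R) (l : nat) :
  Nw m l `|la| `|mu| `|nu| = Nw m l la mu nu.
Proof. by rewrite /Nw !real_normK ?num_real. Qed.

Lemma Gminus2_le (R : realType) (p n G : R) (l : nat) (la mu nu : R) :
  kato_bound 2 p n G -> 1 <= p -> (0 < l)%N ->
  Gminus2 p n l la mu nu <= G.
Proof.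
move=> hG p1 l0.
apply: le_trans (kato_planar_le `|la| `|mu| `|nu| hG isT l0).
rewrite !Nw_abs /Gminus2 divff// powRr1 ?mulr_ge0 ?pi_ge0//.
rewrite (_ : 2 * Num.sqrt 2 / (2 * pi) = Num.sqrt 2 / pi); last first.
  by rewrite -mulf_div divff// mul1r.
rewrite ler_wpM2l ?divr_ge0 ?sqrtr_ge0 ?pi_ge0// ler_wpM2r ?Sw2_le_Splanar//.
have N0 m : 0 <= Nw m l la mu nu by rewrite sqrtr_ge0.
by rewrite invr_ge0 !(N0, powR_ge0, mulr_ge0, addr_ge0).
Qed.

Theorem proposition10p1 (R : realType) (d : nat) (p n G : R)
    (hd : (2 <= d)%N) (hn : d%:R / 2 + 1 < n) (hpn : n <= p)
    (hG : is_sharp_kato d p n G) :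
  [/\ (3 <= d)%N ->
        forall (l : nat) (la mu nu : R), (1 <= l)%N ->
          Gminus3 d p n l la mu nu <= G,
      d = 2%N ->
        forall (l : nat) (la mu nu : R), (1 <= l)%N ->
          Gminus2 p n l la mu nu <= G &
      (ereal_sup [set x : \bar R | exists (l : nat) (la mu nu : R),
          (1 <= l)%N /\ x = (Gminus d p n l la mu nu)%:E] <= G%:E)%E].
Proof.
have [bound _] := hG.
have p1 : 1 <= p.
  apply: le_trans hpn; apply: le_trans (ltW hn).
  by rewrite lerDr divr_ge0 ?ler0n.
have g3 : (3 <= d)%N -> forall l la mu nu, (1 <= l)%N ->
    Gminus3 d p n l la mu nu <= G.
  by move=> d3 l la mu nu l1; exact: Gminus3_le.
have g2 : d = 2%N -> forall l la mu nu, (1 <= l)%N ->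
    Gminus2 p n l la mu nu <= G.
  by move=> d2 l la mu nu l1; apply: Gminus2_le => //; rewrite -d2.
split=> //; apply: ge_ereal_sup => _ [l [la [mu [nu [l1 ->]]]]].
rewrite lee_fin /Gminus; case: eqP => [d2|d2]; first exact: g2.
by apply: g3 => //; rewrite ltn_neqAle hd andbT eq_sym; apply/eqP.
Qed.
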